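(* Let $(Y_t)_{t\ge 0}$ be the number-of-customers process of an $M/G/\infty$ queue with arrival rate $\lambda\in(0,\infty)$ and generic service time $S\ge 0$, empty at time $0$. Fix $q\in(0,1)$, let $\gamma_q = 1-q-q\ln q^{-1}$ (which is strictly positive), and assume that $$\int_0^\infty \exp\big(-\gamma_q\,\lambda\,\mathbb{E}(S\wedge t)\big)\,dt<\infty.$$ Then $$\mathbb{P}\big[\,Y_t\ge q\,\lambda\,\mathbb{E}(S\wedge t)\ \text{for all large enough } t\,\big]=1.$$
   Context: $a\wedge b=\min(a,b)$. The $M/G/\infty$ queue: customers arrive according to a Poisson process on $[0,\infty)$ with rate $\lambda$; each customer enters service immediately upon arrival; the service times are i.i.d. nonnegative (finite-valued) random variables, independent of the arrival process, with the same distribution as a generic random variable $S$ (a general distribution). At time $0$ there are no customers in the system. $Y_t$ denotes the number of customers being served at time $t$. Equivalently, take a Poisson point process on $\mathbb{R}_+^2$ with intensity measure $\lambda\,dt\times dF_S(u)$, where $F_S(u)=\mathbb{P}[S\le u]$; a point $(s,u)$ represents a customer arriving at time $s$ with service duration $u$, and $Y_t$ is the number of points $(s,u)$ with $0\le s\le t$ and $u\ge t-s$. *)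

(* Defs.v *)
From HB Require Import structures.
From mathcomp Require Import all_boot all_order all_algebra finmap.
From mathcomp Require Import all_classical all_reals all_analysis.
From mathcomp Require Import measurable_realfun.

Set Implicit Arguments.
Unset Strict Implicit.
Unset Printing Implicit Defensive.

Import Order.TTheory GRing.Theory Num.Theory.
Import numFieldNormedType.Exports.

Local Open Scope classical_set_scope.
Local Open Scope ring_scope.

Section independence.
Context {d d' : measure_display} {T : measurableType d}
  {T' : measurableType d'} {R : realType} (P : probability T R).

Definition mutually_independent (I : choiceType) (X : I -> T -> T') : Prop :=
  forall (J : {fset I}) (B : I -> set T'),
    (forall i, i \in J -> measurable (B i)) ->
    P (\bigcap_(i in [set` J]) (X i @^-1` B i)) =
    (\prod_(i <- J) P (X i @^-1` B i))%E.

(* sigma(X_i, i : I) *)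
Definition sigma_of (I : Type) (X : I -> T -> T') : set (set T) :=
  <<s \bigcup_i preimage_set_system setT (X i) measurable >>.

Definition independent_families (I : Type) (X Y : I -> T -> T') : Prop :=
  forall E F : set T, sigma_of X E -> sigma_of Y F ->
    P (E `&` F) = (P E * P F)%E.

End independence.

Section MGinfty.
Context {d : measure_display} {T : measurableType d} {R : realType}
  (P : probability T R).

(* Number of n with A_n in ]s, t]; it may be +oo, though for a Poisson process
   only on a null set. *)
Definition arrivals (A : nat -> {RV P >-> R}) (s t : R) (w : T) : \bar R :=
  counting [set n | s < A n w <= t].

(* A_0 <= A_1 <= ... are the successive arrival times of a Poisson process on
   [0, +oo[ with rate lambda, i.e. N_t = arrivals A 0 t starts at 0 and has
   independent Poisson increments. Times are compared with s < t below because
   poisson_pmf is not the Dirac mass at 0 when its rate is 0. *)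
Record poisson_process (lambda : R) (A : nat -> {RV P >-> R}) : Prop := {
  arrival_gt0 : {ae P, forall w, forall n, 0 < A n w} ;
  arrival_nondecreasing :
    {ae P, forall w, {homo (fun n => A n w) : m n / (m <= n)%N >-> m <= n}} ;
  increment_poisson : forall (s t : R) (k : nat), 0 <= s -> s < t ->
    P [set w | arrivals A s t w = k%:R%:E] =
    (poisson_pmf (lambda * (t - s)) k)%:E ;
  increment_independent : forall u : nat -> R, 0 <= u 0%N ->
    {homo u : m n / (m <= n)%N >-> m <= n} ->
    mutually_independent P (fun i => arrivals A (u i) (u i.+1))
}.

(* Customer n arrives at time A n and requires service for a duration V n. *)
Record MGinfty_input (lambda : R) (S : {RV P >-> R})
    (A V : nat -> {RV P >-> R}) : Prop := {
  input_arrivals : poisson_process lambda A ;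
  service_law : forall (n : nat) (B : set R), measurable B ->
    distribution P (V n) B = distribution P S B ;
  service_independent : mutually_independent P (fun n => V n : T -> R) ;
  service_indep_arrivals :
    independent_families P (fun n => A n : T -> R) (fun n => V n : T -> R)
}.

(* Y_t, for a system empty at time 0 *)
Definition in_service (A V : nat -> {RV P >-> R}) (t : R) (w : T) : \bar R :=
  counting [set n | 0 <= A n w <= t /\ t - A n w <= V n w].

(* E(S /\ t), a real number since 0 <= S /\ t <= t when S, t >= 0 *)
Definition truncated_mean (S : {RV P >-> R}) (t : R) : R :=
  fine ('E_P[fun w => Num.min (S w) t]).

End MGinfty.

Definition gamma_ {R : realType} (q : R) : R := 1 - q - q * ln q^-1.

(* Main.v *)
(* A customer who arrived in ]i, i+1], i < n, and whose service lasts at least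
   n + 1 - i is in service throughout [n, n+1]. Let Z_n be the number of these
   customers. Thinning the arrivals of each unit interval shows that Z_n is a
   Poisson variable of mean
   lambda * sum_(i < n) P(S >= n + 1 - i) >= lambda * (E(S /\ (n+1)) - 2), so
   Chernoff's bound P(Z_n < x) <= q^-x * E(q^Z_n) at
   x = q * lambda * E(S /\ (n+1)) gives
   P(Z_n < x) <= exp(2 lambda (1 - q)) * exp(-gamma_q lambda E(S /\ (n+1))).
   By monotonicity of t |-> E(S /\ t) the right-hand sides are summable when the
   integral is finite, and by Borel-Cantelli, almost surely,
   Y_t >= Z_n >= q lambda E(S /\ (n+1)) >= q lambda E(S /\ t) on [n, n+1] for
   all large n. *)
Require Import Defs.
From HB Require Import structures.
From mathcomp Require Import all_boot all_order all_algebra finmap.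
From mathcomp Require Import all_classical all_reals all_analysis.
From mathcomp Require Import measurable_realfun.
From mathcomp Require Import ring lra.

Import Order.TTheory GRing.Theory Num.Theory.
Import numFieldNormedType.Exports.

Local Open Scope classical_set_scope.
Local Open Scope ring_scope.

(** This is the strict inequality [1 + x < expR x] at [x = - ln q], multiplied by [q]. *)
Lemma gamma_gt0 (R : realType) (q : R) : 0 < q -> q < 1 -> 0 < gamma_ q.
Proof.
move=> q0 q1; rewrite /gamma_ lnV ?posrE//.
have l0 : ln q != 0 by rewrite lt_eqF// ln_lt0// q0.
have /expR_gt1Dx : - ln q != 0 by rewrite oppr_eq0.
rewrite expRN lnK ?posrE// -(ltr_pM2l q0) divff ?gt_eqF//; lra.
Qed.

(** * Expectations of finite products of simple functions *)

Lemma indic_bigsetI (T I : Type) (R : pzRingType) (r : seq I) (F : I -> set T)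
    (w : T) :
  \1_(\big[setI/setT]_(i <- r) F i) w = \prod_(i <- r) \1_(F i) w :> R.
Proof.
elim: r => [|i r IH]; first by rewrite !big_nil indicT.
by rewrite !big_cons indicI /= IH.
Qed.

Section prod_of_simple.
Context {d : measure_display} {T : measurableType d} {R : realType}.
Variables (P : probability T R) (K J : finType) (E : set T).
Variables (c : K -> J -> R) (F : K -> J -> set T).
Hypotheses (mE : measurable E) (c_ge0 : forall k j, 0 <= c k j)
  (mF : forall k j, measurable (F k j)).

(** Distributing the product over the sums leaves one indicator of an intersection for each choice
    [f] of a term in every factor. *)
Lemma integral_prod_sum_indic :
  (\int[P]_w (\1_E w * \prod_k \sum_j c k j * \1_(F k j) w)%:E)%E =
  (\sum_(f : {ffun K -> J}) (\prod_k c k (f k)) *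
    fine (P (E `&` \big[setI/setT]_k F k (f k))))%:E.
Proof.
transitivity (\int[P]_w (\sum_(f : {ffun K -> J}) ((\prod_k c k (f k)) *
    \1_(E `&` \big[setI/setT]_k F k (f k)) w)%:E))%E.
  apply: eq_integral => w _; rewrite bigA_distr_bigA sumEFin mulr_sumr.
  congr _%:E; apply: eq_bigr => f _.
  by rewrite big_split/= indicI/= indic_bigsetI mulrCA.
have mEF (f : {ffun K -> J}) :
    measurable (E `&` \big[setI/setT]_k F k (f k)).
  by apply: measurableI => //; exact: bigsetI_measurable.
have c0 (f : {ffun K -> J}) : 0 <= \prod_k c k (f k) by exact: prodr_ge0.
rewrite ge0_integral_sum//; last 2 first.
- move=> f; apply/measurable_EFinP; apply: measurable_funM => //.
- by move=> f w _; rewrite lee_fin mulr_ge0.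
rewrite -sumEFin; apply: eq_bigr => f _.
under eq_integral do rewrite EFinM.
rewrite ge0_integralZl//.
- by rewrite integral_indic// setIT EFinM fineK// fin_num_measure.
- exact/measurable_EFinP.
- by rewrite lee_fin.
Qed.

(** Each probability in the expansion factors, and the sum over [f] folds back into a product of
    sums. *)
Lemma integral_prod_indep :
  (forall f : {ffun K -> J}, P (E `&` \big[setI/setT]_k F k (f k)) =
    P E * \prod_k P (F k (f k)))%E ->
  (\int[P]_w (\1_E w * \prod_k \sum_j c k j * \1_(F k j) w)%:E)%E =
  (fine (P E) * \prod_k \sum_j c k j * fine (P (F k j)))%:E.
Proof.
move=> PEF; rewrite integral_prod_sum_indic bigA_distr_bigA mulr_sumr.
congr _%:E; apply: eq_bigr => f _; rewrite big_split/= mulrCA; congr (_ * _).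
rewrite PEF (eq_bigr (fun k => (fine (P (F k (f k))))%:E)); last first.
  by move=> k _; rewrite fineK// fin_num_measure.
by rewrite prodEFin fineM// fin_num_measure.
Qed.

End prod_of_simple.

(** * Independence for finitely many indices *)

Lemma mutually_independent_ord (d d' : measure_display) (T : measurableType d)
    (T' : measurableType d') (R : realType) (P : probability T R)
    (X : nat -> T -> T') (n : nat) (B : 'I_n -> set T') :
  mutually_independent P X -> (forall i, measurable (B i)) ->
  P (\big[setI/setT]_(i < n) X i @^-1` B i) =
  (\prod_(i < n) P (X i @^-1` B i))%E.
Proof.
(* Independence is stated for families of sets over all of [nat]; [C] extends [B] by [setT] from [n]
   on. *)
pose C i := if insub i is Some k then B k else setT.
move=> /(_ (seq_fset tt (iota 0 n)) C) indep mB.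
have C_ord (i : 'I_n) : B i = C i by rewrite /C valK.
have E : perm_eq (seq_fset tt (iota 0 n)) (iota 0 n).
  apply: uniq_perm; rewrite ?fset_uniq ?iota_uniq// => i.
  by rewrite seq_fsetE.
under eq_bigr do rewrite C_ord; under [RHS]eq_bigr do rewrite C_ord.
rewrite -(big_mkord xpredT (fun i => X i @^-1` C i)).
rewrite -(big_mkord xpredT (fun i => P (X i @^-1` C i))).
rewrite /index_iota subn0 -(perm_big _ E) -[RHS](perm_big _ E) -indep//.
  by rewrite bigcap_fset.
by move=> i _; rewrite /C; case: insubP.
Qed.

Section sigma_of.
Context {d d' : measure_display} {T : measurableType d}
  {T' : measurableType d'} {I : Type}.
Variable X : I -> T -> T'.

Lemma sigma_of_preimage i B : measurable B -> sigma_of X (X i @^-1` B).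
Proof.
move=> mB; apply: sub_sigma_algebra; exists i => //.
by exists B => //; rewrite setTI.
Qed.

Lemma sigma_of_bigsetI (J : Type) (r : seq J) (E : J -> set T) :
  (forall j, sigma_of X (E j)) -> sigma_of X (\big[setI/setT]_(j <- r) E j).
Proof.
move=> XE; pose G := \bigcup_i preimage_set_system setT (X i) measurable.
by apply: (@bigsetI_measurable _ (g_sigma_algebraType G)) => j _; exact: XE.
Qed.

End sigma_of.

(** * Sorting arrival times into unit intervals *)

Section block.
Context {R : realType} {n : nat}.
Implicit Types (x : R) (i : 'I_n).

(** The value is [None] outside []0, n]]. With finitely many values, conditioning on the blocks of
    finitely many customers is a finite sum. *)
Definition block x : option 'I_n := [pick i : 'I_n | i%:R < x <= i.+1%:R].

Lemma blockP x i : block x = Some i <-> i%:R < x <= i.+1%:R.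
Proof.
rewrite /block; case: pickP => [j /andP[jx xj]|none]; last first.
  by split => //; rewrite none.
split=> [[<-]|/andP[ix xi]]; first by rewrite jx xj.
have := lt_le_trans jx xi; have := lt_le_trans ix xj; rewrite !ltr_nat !ltnS.
by move=> ij ji; congr Some; apply/val_inj/anti_leq; rewrite /= ij ji.
Qed.

Lemma measurable_block o : measurable (block @^-1` [set o]).
Proof.
have mS i : measurable (block @^-1` [set Some i]).
  rewrite (_ : _ @^-1` _ = `]i%:R, i.+1%:R]%classic)//.
  by apply/seteqP; split=> x /=; rewrite in_itv/= => /blockP.
case: o => [//|]; rewrite (_ : _ @^-1` _ =
    \bigcap_(i in [set: 'I_n]) ~` (block @^-1` [set Some i])).
  by apply: fin_bigcap_measurable => // i _; exact: measurableC.
apply/seteqP; split=> x /= xN; first by move=> i _ /=; rewrite xN.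
by case E : (block x) => [i|//]; have := xN i I; rewrite /= E.
Qed.

End block.

(** * Counting measure and Poisson sums *)

Section counting_nat.
Context {R : realType}.
Implicit Type B : set nat.

Lemma counting_ge B K :
  (((\sum_(k < K) (val k \in B))%N%:R : R)%:E <= counting B)%E.
Proof.
rewrite counting_dirac (le_trans _ (nneseries_lim_ge K _))//.
by rewrite big_mkord natr_sum -sumEFin lee_sum.
Qed.

Lemma counting_bounded B K : (forall k, (K <= k)%N -> ~ B k) ->
  counting B = ((\sum_(k < K) (val k \in B))%N%:R : R)%:E.
Proof.
move=> BK; rewrite counting_dirac (@nneseries_split _ _ 0 K)// add0n eseries0.
  by rewrite adde0 big_mkord natr_sum -sumEFin.
by move=> k Kk _; rewrite diracE memNset//; exact: BK.
Qed.

Lemma counting_fin_bounded B (m : nat) : counting B = (m%:R : R)%:E ->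
  exists K, forall k, (K <= k)%N -> ~ B k.
Proof.
rewrite /counting; case: asboolP => // finB _.
exists (\max_(k <- fset_set B) k).+1 => k; rewrite ltnNge => /negP Kk Bk.
by apply: Kk; apply: leq_bigmax_seq => //; rewrite in_fset_set// inE.
Qed.

End counting_nat.

Section poisson_sums.
Context {R : realType}.

Lemma sum_poisson_pmf (r : R) : 0 < r ->
  (\sum_(k <oo) (poisson_pmf r k)%:E = 1)%E.
Proof.
move=> r0; rewrite nneseries_esumT; last first.
  by move=> k; rewrite lee_fin poisson_pmf_ge0.
by have := probability_setT (poisson_prob r 0%N); rewrite /= /poisson_prob r0.
Qed.

(** Up to the factor [expR (- r)], the left-hand side is a partial sum of the exponential series at
    [a * r], whose terms are nonnegative. *)
Lemma poisson_pgf_le (r a : R) K : 0 < r -> 0 <= a ->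
  \sum_(k < K) a ^+ k * poisson_pmf r k <= expR (- (r * (1 - a))).
Proof.
move=> r0 a0; rewrite (_ : - _ = - r + a * r); last by ring.
rewrite expRD [in leRHS]/expR.
under eq_bigr do rewrite /poisson_pmf r0 mulrA mulrA -exprMn mulrC.
rewrite -mulr_sumr ler_wpM2l ?expR_ge0//.
rewrite -[leLHS](big_mkord xpredT (exp_coeff (a * r))).
apply: (nondecreasing_cvgn_le _ (is_cvg_series_exp_coeff (a * r))).
apply/nondecreasing_seqP => k; rewrite seriesSr lerDl.
by rewrite divr_ge0// exprn_ge0// mulr_ge0// ltW.
Qed.

End poisson_sums.

(** * Truncating the arrival process to finitely many customers *)

Section arrivals.
Context {d : measure_display} {T : measurableType d} {R : realType}.
Variables (P : probability T R) (lambda : R) (A : nat -> {RV P >-> R}).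
Hypotheses (poisson_A : poisson_process lambda A) (lambda_gt0 : 0 < lambda).

Lemma measurable_arrival_in k (s t : R) :
  measurable (A k @^-1` `]s, t]%classic).
Proof. exact: measurable_funPTI. Qed.

Lemma measurable_arrivals (s t : R) : measurable_fun setT (arrivals A s t).
Proof.
rewrite (_ : arrivals A s t = fun w =>
    (\sum_(k <oo) (\1_(A k @^-1` `]s, t]%classic) w)%:E)%E).
  apply: ge0_emeasurable_sum => k; first by move=> w _ _; rewrite lee_fin.
  by move=> _; apply/measurable_EFinP/measurable_indic/measurable_arrival_in.
apply/funext => w; rewrite /arrivals counting_dirac; apply: eq_eseriesr => k _.
by rewrite diracE indicE; congr (_%:R%:E); apply/idP/idP; rewrite !inE/= in_itv.
Qed.

Lemma measurable_arrivals_eq (s t : R) x :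
  measurable [set w | arrivals A s t w = x].
Proof.
rewrite (_ : [set _ | _] = setT `&` arrivals A s t @^-1` [set x]).
  by apply: measurable_arrivals => //; exact: emeasurable_set1.
by rewrite setTI.
Qed.

(** Off this event, the first [K] customers include all arrivals in []s, t]], so truncation loses
    none of them. *)
Definition late_arrival (s t : R) K : set T :=
  \bigcup_(k in [set k | (K <= k)%N]) (A k @^-1` `]s, t]%classic).

Lemma measurable_late_arrival s t K : measurable (late_arrival s t K).
Proof. by apply: bigcup_measurable => k _; exact: measurable_arrival_in. Qed.

(** These events decrease to the event of infinitely many arrivals in []s, t]]. It is null because
    the Poisson weights sum to one, so that the count is almost surely finite. *)
Lemma late_arrival_cvg0 (s t : R) : 0 <= s -> s < t ->
  P (late_arrival s t K) @[K --> \oo] --> 0%E.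
Proof.
move=> s0 st; pose F k := A k @^-1` `]s, t]%classic.
suff <- : P (lim_sup_set F) = 0%E.
  apply: lim_sup_set_cvg => [k|]; first exact: measurable_arrival_in.
  rewrite (le_lt_trans (probability_le1 _ _)) ?ltry//.
  exact: measurable_late_arrival.
pose N (m : nat) := [set w | arrivals A s t w = m%:R%:E].
have mN m : measurable (N m) by exact: measurable_arrivals_eq.
have PN : P (\bigcup_m N m) = 1%E.
  rewrite measure_bigcup//; last first.
    move=> i j _ _ [w [Ni Nj]]; have [/eqP] := etrans (esym Ni) Nj.
    by rewrite eqr_nat => /eqP.
  rewrite -(sum_poisson_pmf (lambda * (t - s))) ?mulr_gt0 ?subr_gt0//.
  rewrite (@eq_eseriesl _ _ xpredT) => [|m]; last exact: in_setT.
  apply: eq_eseriesr => m _; exact: (increment_poisson poisson_A).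
apply/eqP; rewrite -measure_le0; apply: (@le_trans _ _ (P (~` \bigcup_m N m))).
  apply: le_measure; rewrite ?inE.
  - by apply: bigcap_measurable => // K _; exact: measurable_late_arrival.
  - by apply: measurableC; exact: bigcup_measurable.
  move=> w late [m _ /counting_fin_bounded[K NK]].
  have [k /= Kk] := late K I.
  by rewrite /F /= in_itv /= => skt; exact: (NK k Kk skt).
by rewrite probability_setC ?PN ?subee//; exact: bigcup_measurable.
Qed.

End arrivals.

(** * The truncated mean and its bound by tail probabilities *)

Section truncated_mean.
Context {d : measure_display} {T : measurableType d} {R : realType}.
Variables (P : probability T R) (S : {RV P >-> R}).
Hypothesis S_ge0 : forall w, 0 <= S w.

Lemma measurable_truncation (t : R) :
  measurable_fun setT (fun w => Num.min (S w) t).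
Proof. exact: measurable_minr. Qed.

Lemma truncated_meanE (t : R) : 0 <= t ->
  (truncated_mean S t)%:E = (\int[P]_w (Num.min (S w) t)%:E)%E.
Proof.
move=> t0; rewrite /truncated_mean unlock fineK// ge0_fin_numE.
  rewrite (@le_lt_trans _ _ (\int[P]_w t%:E)%E)//.
    apply: ge0_le_integral => //.
    - by move=> w _; rewrite lee_fin le_min S_ge0.
    - by apply/measurable_EFinP; exact: measurable_truncation.
    - by move=> w _; rewrite lee_fin ge_min lexx orbT.
  rewrite integral_cst// [X in (_ * X)%E](@probability_setT _ _ _ P) mule1.
  exact: ltry.
by apply: integral_ge0 => w _; rewrite lee_fin le_min S_ge0.
Qed.

Lemma truncated_mean_homo (s t : R) : 0 <= s -> s <= t ->
  truncated_mean S s <= truncated_mean S t.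
Proof.
move=> s0 st; have t0 := le_trans s0 st.
rewrite -lee_fin !truncated_meanE//; apply: ge0_le_integral => //.
- by move=> w _; rewrite lee_fin le_min S_ge0.
- by apply/measurable_EFinP; exact: measurable_truncation.
- by apply/measurable_EFinP; exact: measurable_truncation.
- by move=> w _; rewrite lee_fin le_min !ge_min lexx/= st orbT.
Qed.

(** A discrete layer-cake bound. The thresholds start at 2, the service length asked of a customer
    of the last block []n - 1, n]]; this accounts for the constant 2. *)
Lemma min_le_sum (s : R) n :
  Num.min s n.+2%:R <= 2 + \sum_(i < n) (i.+2%:R <= s)%R%:R.
Proof.
elim: n => [|n IH]; first by rewrite big_ord0 addr0 ge_min lexx orbT.
rewrite big_ord_recr addrA /=; have [ns|sn] := leP n.+2%:R s.
  move: IH; rewrite (min_idPr ns) => IH.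
  by rewrite ge_min -[n.+3]addn1 natrD lerD2r IH orbT.
move: IH; rewrite (min_idPl (ltW sn)) addr0; apply: le_trans.
by rewrite ge_min lexx.
Qed.

Lemma truncated_mean_le_sum n : truncated_mean S n.+1%:R <=
  2 + \sum_(i < n) (1 - fine (P (S @^-1` `]-oo, n.+1%:R - i%:R[))).
Proof.
have mS (c : R) : measurable (S @^-1` `]-oo, c[).
  by apply: measurable_funPTI; exact: measurable_itv.
pose F (i : 'I_n) : set T := ~` (S @^-1` `]-oo, n.+1%:R - i%:R[).
have mF i : measurable (F i) by exact: measurableC.
rewrite -lee_fin truncated_meanE//.
apply: (@le_trans _ _ (\int[P]_w (2%:E + \sum_(i < n) (\1_(F i) w)%:E))%E).
  apply: ge0_le_integral => //.
  - by move=> w _; rewrite lee_fin le_min S_ge0/=.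
  - by apply/measurable_EFinP; exact: measurable_truncation.
  - apply: emeasurable_funD => //; apply: emeasurable_sum => i.
    exact/measurable_EFinP.
  move=> w _; rewrite sumEFin lee_fin.
  apply: (@le_trans _ _ (Num.min (S w) n.+2%:R)).
    by rewrite le_min !ge_min lexx/= ler_nat leqnSn orbT.
  (* Reversing the order turns the threshold [i + 2] into [n + 1 - i], the length asked of a
     customer of block [i]. *)
  rewrite (le_trans (min_le_sum _ n))// lerD2l (reindex_inj rev_ord_inj)/=.
  apply: ler_sum => i _; rewrite indicE.
  have [iS|//] := leP (n - i.+1).+2%:R (S w); rewrite mem_set//.
  rewrite /F/= in_itv/=; apply/negP; rewrite -leNgt.
  apply: le_trans iS; rewrite lerBlDr -natrD ler_nat.
  by rewrite subnSK// addSn subnK// ltnW.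
rewrite ge0_integralD//; last 2 first.
- by move=> w _; rewrite sume_ge0.
- by apply: emeasurable_sum => i; exact/measurable_EFinP.
rewrite integral_cst// [X in (_ * X)%E](@probability_setT _ _ _ P) mule1.
rewrite ge0_integral_sum//; last first.
  by move=> i; exact/measurable_EFinP.
rewrite [leRHS]EFinD leeD2l// -sumEFin; apply: lee_sum => i _.
rewrite integral_indic// setIT [leLHS](probability_setC P (mS _)).
by rewrite EFinB fineK// fin_num_measure.
Qed.

End truncated_mean.

(** * Chernoff bound for the number of long services *)

Section tail_bound.
Context {d : measure_display} {T : measurableType d} {R : realType}.
Variables (P : probability T R) (lambda : R) (S : {RV P >-> R}).
Variables (A V : nat -> {RV P >-> R}) (q : R) (n : nat).
Hypotheses (queue : MGinfty_input lambda S A V) (q_gt0 : 0 < q) (q_lt1 : q < 1).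

(* A customer arrived in ]i, i+1] whose service time avoids [short (Some i)] is
   in service throughout [n, n+1]. *)
Definition short (o : option 'I_n) : set R :=
  if o is Some i then `]-oo, n.+1%:R - i%:R[ else setT.

(** The conditional mean of one factor of [weight] given block [o]: the factor is 1 for a short
    service and [q] for a long one. *)
Definition mean_weight (o : option 'I_n) : R :=
  q + (1 - q) * fine (P (S @^-1` short o)).

(* q to the number of long services among the first K customers: the product
   rule for independence is only available for finitely many of them. *)
Definition weight (K : nat) (w : T) : R :=
  \prod_(k < K) (q + (1 - q) * \1_(short (block (A k w))) (V k w)).

Lemma measurable_short o : measurable (short o).
Proof. by case: o => //= i; exact: measurable_itv. Qed.

(** Writes a function of the block as a simple function, the form required by the product
    expansions. *)
Lemma sum_block (f : option 'I_n -> R) x :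
  \sum_o f o * \1_(@block R n @^-1` [set o]) x = f (block x).
Proof.
rewrite (bigD1 (block x))//= big1 ?addr0 => [|o ob].
  by rewrite indicE mem_set ?mulr1.
by rewrite indicE memNset ?mulr0//= => E; rewrite E eqxx in ob.
Qed.

(** Arrival times depend on one another, so only the service factor is split. *)
Lemma preimage_joint_prob K (L B : 'I_K -> set R) :
  (forall k, measurable (L k)) -> (forall k, measurable (B k)) ->
  P (\big[setI/setT]_(k < K) (A k @^-1` L k) `&`
     \big[setI/setT]_(k < K) (V k @^-1` B k)) =
  (P (\big[setI/setT]_(k < K) (A k @^-1` L k)) *
   \prod_(k < K) P (V k @^-1` B k))%E.
Proof.
move=> mL mB; rewrite (service_indep_arrivals queue).
- congr (_ * _)%E.
  apply: (mutually_independent_ord _ _ _ _ _ _ (fun k => V k : T -> R)) => //.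
  exact: service_independent queue.
- by apply: sigma_of_bigsetI => k; exact: sigma_of_preimage.
- by apply: sigma_of_bigsetI => k; exact: sigma_of_preimage.
Qed.

Lemma service_short k o : P (V k @^-1` short o) = P (S @^-1` short o).
Proof. exact: (service_law queue k (measurable_short o)). Qed.

Lemma mean_weight_ge0 o : 0 <= mean_weight o.
Proof. by rewrite addr_ge0 ?mulr_ge0 ?fine_ge0 ?subr_ge0// ltW. Qed.

(** Integrates out the service times given the blocks: split over all assignments [g] of blocks to
    customers, use independence on each event [E g], then reassemble. *)
Lemma expected_weight K :
  (\int[P]_w (weight K w)%:E =
   \int[P]_w (\prod_(k < K) mean_weight (block (A k w)))%:E)%E.
Proof.
have mbk (k : 'I_K) o : measurable (A k @^-1` (@block R n @^-1` [set o])).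
  by apply: measurable_funPTI; exact: measurable_block.
have mw0 := mean_weight_ge0.
pose E (g : {ffun 'I_K -> option 'I_n}) :=
  \big[setI/setT]_(k < K) (A k @^-1` (@block R n @^-1` [set g k])).
(* The factor [q + (1 - q) * \1_short] becomes a two-term sum over [b], to fit
   [integral_prod_indep]. *)
pose c (b : bool) := if b then 1 - q else q.
have c0 b : 0 <= c b by case: b; rewrite /= ?subr_ge0 ltW.
pose F (g : {ffun 'I_K -> option 'I_n}) (k : 'I_K) (b : bool) :=
  V k @^-1` (if b then short (g k) else setT).
have mE g : measurable (E g) by exact: bigsetI_measurable.
have mif (b : bool) o : measurable (if b then short o else setT : set R).
  by case: b => //; exact: measurable_short.
have mF g k b : measurable (F g k b).
  exact: measurable_funPTI.
transitivity (\int[P]_w (\sum_(g : {ffun 'I_K -> option 'I_n})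
    (\1_(E g) w * \prod_k \sum_b c b * \1_(F g k b) w)%:E))%E.
  apply: eq_integral => w _; rewrite sumEFin; congr _%:E.
  transitivity (\prod_(k < K) \sum_o (q + (1 - q) * \1_(short o) (V k w)) *
      \1_(@block R n @^-1` [set o]) (A k w)).
    by apply: eq_bigr => k _; rewrite sum_block.
  rewrite bigA_distr_bigA; apply: eq_bigr => g _.
  rewrite big_split mulrC indic_bigsetI /=; congr (_ * _).
  apply: eq_bigr => k _.
  by rewrite big_bool /c /F preimage_setT indicT mulr1 addrC.
rewrite ge0_integral_sum//; last 2 first.
- move=> g; apply/measurable_EFinP; apply: measurable_funM => //.
  apply: measurable_prod => k _; apply: measurable_sum => b.
  exact: measurable_funM.
- move=> g w _; rewrite lee_fin mulr_ge0// prodr_ge0// => k _.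
  by rewrite sumr_ge0// => b _; rewrite mulr_ge0.
rewrite [RHS](_ : _ = \int[P]_w (\1_setT w * \prod_(k < K) \sum_o
    mean_weight o *
      \1_(A k @^-1` (@block R n @^-1` [set o])) w)%:E)%E; last first.
  apply: eq_integral => w _; rewrite indicT mul1r; congr _%:E.
  by apply: eq_bigr => k _; rewrite -sum_block.
rewrite integral_prod_sum_indic// -sumEFin.
apply: eq_bigr => g _; rewrite integral_prod_indep//; last first.
  by move=> f; rewrite preimage_joint_prob// => k; exact: measurable_block.
rewrite setTI mulrC; congr EFin; congr (_ * _); apply: eq_bigr => k _.
rewrite big_bool /c /F/= preimage_setT probability_setT mulr1 service_short.
exact: addrC.
Qed.

Hypothesis lambda_gt0 : 0 < lambda.

Lemma mean_weight_None : mean_weight None = 1.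
Proof. by rewrite /mean_weight/= preimage_setT probability_setT/=; ring. Qed.

(** Groups the customers by block; those with block [None] contribute a factor 1. *)
Lemma prod_block K (x : 'I_K -> R) :
  \prod_(k < K) mean_weight (block (x k)) =
  \prod_(i < n) mean_weight (Some i) ^+ (\sum_(k < K) (block (x k) == Some i)).
Proof.
under [RHS]eq_bigr do rewrite -prodrXr.
rewrite exchange_big; apply: eq_bigr => k _ /=.
case: (block (x k)) => [j|]; last by rewrite mean_weight_None big1.
rewrite (bigD1 j)//= eqxx expr1 big1 ?mulr1// => i ij.
by rewrite (_ : _ == _ = false) ?expr0//; apply: contraNF ij => /eqP[->].
Qed.

(** On a late arrival the product is at most 1. Otherwise the first [K] customers give the exact
    count of each block, and this count selects one term of the inner sum. *)
Lemma prod_mean_weight_le K w :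
  \prod_(k < K) mean_weight (block (A k w)) <=
  \1_(late_arrival P A 0 n.+1%:R K) w + \prod_(i < n) \sum_(m < K.+1)
    mean_weight (Some i) ^+ m *
    \1_[set w | arrivals A i%:R i.+1%:R w = (m%:R : R)%:E] w.
Proof.
have S0 : 0 <= \prod_(i < n) \sum_(m < K.+1) mean_weight (Some i) ^+ m *
    \1_[set w | arrivals A i%:R i.+1%:R w = (m%:R : R)%:E] w.
  apply: prodr_ge0 => i _; apply: sumr_ge0 => m _.
  by rewrite mulr_ge0// exprn_ge0// mean_weight_ge0.
have mw1 o : mean_weight o <= 1.
  rewrite -[leRHS](subrKC q) lerD2l ler_piMr ?subr_ge0 ?(ltW q_lt1)//.
  have mo : measurable (S @^-1` short o).
    by apply: measurable_funPTI; exact: measurable_short.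
  by rewrite -lee_fin fineK ?fin_num_measure ?probability_le1.
have [late|Nlate] := pselect (late_arrival P A 0 n.+1%:R K w).
  rewrite indicE mem_set//= (@le_trans _ _ 1) ?lerDl//.
  by apply: prodr_ile1 => k _; rewrite mean_weight_ge0 mw1.
rewrite indicE memNset// add0r prod_block; apply: ler_prod => i _.
rewrite exprn_ge0 ?mean_weight_ge0//=.
set N := (\sum_(k < K) _)%N.
have NK : (N < K.+1)%N.
  by rewrite ltnS -[leqRHS]card_ord -sum1_card leq_sum// => k _; case: eqP.
rewrite (bigD1 (Ordinal NK))//= indicE mem_set/= ?mulr1 ?lerDl.
  apply: sumr_ge0 => m _; by rewrite mulr_ge0// exprn_ge0// mean_weight_ge0.
rewrite /arrivals (counting_bounded _ K) => [|k Kk /andP[ik ki]].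
  congr (_%:R%:E); apply: eq_bigr => k _; congr nat_of_bool.
  by apply/idP/eqP; rewrite inE/= blockP.
apply: Nlate; exists k => //=; rewrite in_itv/= (le_lt_trans _ ik)//=.
by rewrite (le_trans ki)// ler_nat ltnS ltnW.
Qed.

Lemma measurable_weight K : measurable_fun setT (weight K).
Proof.
rewrite (_ : weight K = fun w => \prod_(k < K) \sum_o
    (q + (1 - q) * \1_(V k @^-1` short o) w) *
      \1_(A k @^-1` (@block R n @^-1` [set o])) w).
  apply: measurable_prod => k _; apply: measurable_sum => o.
  apply: measurable_funM; last first.
    apply: measurable_indic; apply: measurable_funPTI.
    exact: measurable_block.
  apply: measurable_funD => //; apply: measurable_funM => //.
  by apply: measurable_indic; apply: measurable_funPTI; exact: measurable_short.
by apply/funext => w; apply: eq_bigr => k _; rewrite sum_block.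
Qed.

Lemma weight_ge0 K w : 0 <= weight K w.
Proof.
apply: prodr_ge0 => k _.
by rewrite addr_ge0 ?mulr_ge0 ?subr_ge0// ltW.
Qed.

(** The counts of the unit blocks are independent Poisson variables of mean [lambda], so the product
    of the inner sums is bounded by Poisson generating functions at [mean_weight (Some i)]. This
    replaces an explicit thinning. *)
Lemma expected_weight_le K : (\int[P]_w (weight K w)%:E <=
  P (late_arrival P A 0 n.+1%:R K) +
  (expR (- (lambda * \sum_(i < n) (1 - mean_weight (Some i)))))%:E)%E.
Proof.
have pp := input_arrivals queue.
pose c (i : 'I_n) (m : 'I_K.+1) := mean_weight (Some i) ^+ m.
pose F (i : 'I_n) (m : 'I_K.+1) :=
  [set w | arrivals A i%:R i.+1%:R w = (m%:R : R)%:E].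
have c0 i m : 0 <= c i m by rewrite exprn_ge0// mean_weight_ge0.
have mF i m : measurable (F i m) by exact: measurable_arrivals_eq.
have mlate := measurable_late_arrival P A 0 n.+1%:R K.
have mS : measurable_fun setT (fun w => \prod_i \sum_m c i m * \1_(F i m) w).
  apply: measurable_prod => i _; apply: measurable_sum => m.
  exact: measurable_funM.
rewrite expected_weight; apply: (@le_trans _ _ (\int[P]_w
    ((\1_(late_arrival P A 0 n.+1%:R K) w)%:E +
     (\prod_i \sum_m c i m * \1_(F i m) w)%:E))%E).
  apply: ge0_le_integral => //.
  - by move=> w _; rewrite lee_fin prodr_ge0// => k _; exact: mean_weight_ge0.
  - apply/measurable_EFinP; apply: measurable_prod => k _.
    under eq_fun do rewrite -sum_block.
    apply: measurable_sum => o; apply: measurable_funM => //.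
    apply: measurable_indic.
    by apply: (measurable_funPTI (A k)); exact: measurable_block.
  - by apply: emeasurable_funD; apply/measurable_EFinP.
  - by move=> w _; rewrite -EFinD lee_fin prod_mean_weight_le.
rewrite ge0_integralD//; last 3 first.
- by apply/measurable_EFinP.
- move=> w _; rewrite lee_fin prodr_ge0// => i _.
  by rewrite sumr_ge0// => m _; rewrite mulr_ge0.
- exact/measurable_EFinP.
rewrite integral_indic// setIT leeD2l//.
rewrite [leLHS](_ : _ = \int[P]_w
    (\1_setT w * \prod_i \sum_m c i m * \1_(F i m) w)%:E)%E; last first.
  by apply: eq_integral => w _; rewrite indicT mul1r.
rewrite integral_prod_indep//; last first.
  move=> f; rewrite setTI probability_setT mul1e.
  have incr_indep : mutually_independent P
      (fun k : nat => arrivals A k%:R k.+1%:R).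
    apply: (@increment_independent _ _ _ _ _ _ pp (fun k => k%:R)) => // i j.
    by move=> ij; rewrite ler_nat.
  apply: (mutually_independent_ord _ _ _ _ _ P _ _
    (fun i => [set ((f i)%:R : R)%:E]) incr_indep) => i.
  exact: emeasurable_set1.
rewrite probability_setT mul1r lee_fin mulr_sumr -sumrN expR_sum.
apply: ler_prod => i _; apply/andP; split.
  by apply: sumr_ge0 => m _; rewrite mulr_ge0// fine_ge0.
apply: le_trans (poisson_pgf_le _ _ K.+1 lambda_gt0 (mean_weight_ge0 _)).
apply: ler_sum => m _; rewrite /F (increment_poisson pp)// ?ltr_nat//.
by rewrite -natrB// subSnn mulr1.
Qed.

(** This is the event [Z_n <= x]: [expR (x * ln q)] is [q] to the real power [x], and [q < 1]
    reverses the order. Quantifying over [K] removes the truncation. *)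
Definition few_long_services (x : R) : set T :=
  \bigcap_K [set w | expR (x * ln q) <= weight K w].

Lemma measurable_few_long_services x : measurable (few_long_services x).
Proof.
apply: bigcapT_measurable => K.
rewrite (_ : [set w | _] = setT `&` weight K @^-1` `[expR (x * ln q), +oo[).
  by apply: measurable_weight => //; exact: measurable_itv.
by rewrite setTI; apply/seteqP; split=> w /=; rewrite in_itv/= andbT.
Qed.

(** Markov's inequality for [weight K]. The event does not depend on [K], so letting [K] tend to
    infinity removes the late-arrival error. *)
Lemma few_long_services_prob x : (P (few_long_services x) <=
  (expR (- (x * ln q) -
    lambda * \sum_(i < n) (1 - mean_weight (Some i))))%:E)%E.
Proof.
have mB := measurable_few_long_services x.
set C := expR (- (lambda * \sum_(i < n) (1 - mean_weight (Some i)))).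
have markov K : ((expR (x * ln q))%:E * P (few_long_services x) <=
    P (late_arrival P A 0 n.+1%:R K) + C%:E)%E.
  apply: le_trans (expected_weight_le K).
  rewrite -[few_long_services x]setIT -integral_indic//.
  rewrite -ge0_integralZl// ?lee_fin ?expR_ge0//; last first.
    exact/measurable_EFinP.
  apply: ge0_le_integral => //.
  - by apply/measurable_EFinP; exact: measurable_funM.
  - by apply/measurable_EFinP; exact: measurable_weight.
  - move=> w _; rewrite -EFinM lee_fin indicE.
    have [/set_mem/(_ K I)|] := boolP (w \in _); first by rewrite mulr1.
    by rewrite mulr0 weight_ge0.
have : ((expR (x * ln q))%:E * P (few_long_services x) <= 0 + C%:E)%E.
  (* The endpoint [n + 1], rather than [n], keeps the interval nondegenerate when [n = 0]. *)
  have late := late_arrival_cvg0 P lambda A (input_arrivals queue) lambda_gt0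
    0 n.+1%:R (lexx 0) (ltr0Sn _ _).
  have cv : (P (late_arrival P A 0 n.+1%:R K) + C%:E)%E @[K --> \oo] -->
      (0 + C%:E)%E by apply: cvgeD => //; exact: cvg_cst.
  by apply: (cvge_ge _ cv); apply: nearW => K; exact: markov.
rewrite add0e expRD expRN -/C EFinM lee_pdivlMl ?expR_gt0//.
Qed.

(** A long service starts in some []i, i + 1]] with [i + 1 <= n <= t] and lasts at least
    [n + 1 - i], hence beyond [t]. So [q ^+ Z <= weight K w < q^x] for some [K], which gives
    [x < Z]. *)
Lemma in_service_ge x t w : n%:R <= t -> t <= n.+1%:R ->
  ~ few_long_services x w -> (x%:E <= in_service A V t w)%E.
Proof.
move=> nt tn few.
pose B := [set k | 0 <= A k w <= t /\ t - A k w <= V k w].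
have [K Kx] : exists K, weight K w < expR (x * ln q).
  apply: contrapT => /forallNP nK; apply: few => K _ /=.
  by rewrite leNgt; apply/negP; exact: nK.
apply: le_trans (counting_ge B K); rewrite lee_fin.
set Z := (\sum_(k < K) _)%N.
have ZW : q ^+ Z <= weight K w.
  rewrite /Z -prodrXr; apply: ler_prod => k _.
  rewrite exprn_ge0 ?(ltW q_gt0)//=.
  have [sk|lk] := pselect (short (block (A k w)) (V k w)).
    by rewrite indicE (mem_set sk) mulr1 subrKC exprn_ile1 ?ltW.
  rewrite indicE (memNset lk) mulr0 addr0 mem_set ?expr1//.
  move: lk; case bA : (block (A k w)) => [i|]; last by move=> /(_ I).
  have /blockP/andP[iA Ai] := bA.
  rewrite /short/= in_itv/= => /negP; rewrite -leNgt => iV.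
  have in_n : (i.+1%:R : R) <= n%:R by rewrite ler_nat.
  have i0 : (0 : R) <= i%:R by [].
  rewrite /B /=; split; first by apply/andP; split; lra.
  lra.
have lnq : ln q < 0 by rewrite ln_lt0// q_gt0.
have := le_lt_trans ZW Kx; rewrite -[X in X ^+ _](lnK q_gt0) -expRM_natl.
by rewrite ltr_expR ltr_nM2r// => /ltW.
Qed.

Hypothesis S_ge0 : forall w, 0 <= S w.

(** With [m] the truncated mean, the tail sum [p] is at least [m - 2], and [- q lambda m ln q -
    lambda (1 - q) (m - 2)] equals [2 lambda (1 - q) - gamma_q lambda m]. *)
Lemma few_long_services_le :
  (P (few_long_services (q * lambda * truncated_mean S n.+1%:R)) <=
   (expR (2 * lambda * (1 - q)))%:E *
   (expR (- (gamma_ q * lambda * truncated_mean S n.+1%:R)))%:E)%E.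
Proof.
apply: (le_trans (few_long_services_prob _)).
rewrite -EFinM -expRD lee_fin ler_expR /gamma_ lnV ?posrE//.
have -> : \sum_(i < n) (1 - mean_weight (Some i)) = (1 - q) *
    \sum_(i < n) (1 - fine (P (S @^-1` `]-oo, n.+1%:R - i%:R[))).
  by rewrite mulr_sumr; apply: eq_bigr => i _; rewrite /mean_weight/=; ring.
have := truncated_mean_le_sum P S S_ge0 n.
move: (\sum_(i < n) _) => p le_p.
have : 0 <= lambda * (1 - q) * (2 + p - truncated_mean S n.+1%:R).
  by rewrite !mulr_ge0 ?subr_ge0// ltW.
lra.
Qed.

End tail_bound.

(** * Integral comparison and the Borel-Cantelli conclusion *)

Lemma nneseries_le_integral (R : realType) (g : R -> R) :
  (forall t, 0 <= g t) -> (forall s t, 0 <= s -> s <= t -> g t <= g s) ->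
  (\sum_(n <oo) (g n.+1%:R)%:E <=
   \int[lebesgue_measure]_(t in `[0%R, +oo[) (g t)%:E)%E.
Proof.
move=> g0 g_anti.
(* Monotonicity is known only on [[0, +oo[]; precomposing with [Num.max t 0] makes it global, and
   the double negation makes it nondecreasing. *)
have mg : measurable_fun (`[0, +oo[%classic : set R) g.
  apply: (eq_measurable_fun (fun t : R => - (- g (Num.max t 0)))).
    by move=> t; rewrite inE/= in_itv/= andbT opprK => /max_idPl ->.
  apply: measurableT_comp => //; apply: nondecreasing_measurable => // s t st.
  rewrite lerN2 g_anti//; first by rewrite le_max lexx orbT.
  by rewrite ge_max !le_max st lexx orbT.
pose F n : set R := `[n%:R, n.+1%:R[%classic.
have mF n : measurable (F n) by exact: measurable_itv.
have sF : \bigcup_n F n `<=` (`[0, +oo[%classic : set R).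
  move=> t [n _]; rewrite /F/= !in_itv/= andbT => /andP[nt _].
  by rewrite (le_trans _ nt).
have mgF : measurable_fun (\bigcup_n F n) (EFin \o g).
  apply/measurable_EFinP; apply: measurable_funS mg => //.
have trivF : trivIset setT F.
  move=> i j _ _ [t []]; rewrite /F/= !in_itv/= => /andP[it ti] /andP[jt tj].
  have := le_lt_trans it tj; have := le_lt_trans jt ti; rewrite !ltr_nat !ltnS.
  by move=> ji ij; apply: anti_leq; rewrite ij ji.
apply: (@le_trans _ _ (\int[lebesgue_measure]_(t in \bigcup_n F n) (g t)%:E)%E).
  rewrite ge0_integral_bigcup//; last by move=> t _; rewrite lee_fin.
  apply: lee_nneseries => [n _ _|n _]; first by rewrite lee_fin.
  rewrite [leLHS](_ : _ = \int[lebesgue_measure]_(t in F n) (g n.+1%:R)%:E)%E.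
    apply: ge0_le_integral => //.
    - exact: mF.
    - by move=> t _; rewrite lee_fin.
    - apply: measurable_funS mgF => //; first exact: bigcup_measurable.
      exact: bigcup_sup.
    - move=> t; rewrite /F/= in_itv/= => /andP[nt tn].
      by rewrite lee_fin g_anti// ?(ltW tn)// (le_trans _ nt).
  rewrite integral_cst; last exact: mF.
  rewrite /F/= lebesgue_measure_itv/= lte_fin ltr_nat ltnS leqnn.
  by rewrite -EFinB -natrB// subSnn mule1.
apply: ge0_subset_integral => //.
- by apply: bigcup_measurable => n _; exact: mF.
- exact/measurable_EFinP.
- by move=> t _; rewrite lee_fin.
Qed.

Theorem theorem2 (d : measure_display) (T : measurableType d) (R : realType)
  (P : probability T R) (lambda : R) (S : {RV P >-> R})
  (A V : nat -> {RV P >-> R}) (q : R)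
  (lambda_gt0 : 0 < lambda)
  (S_ge0 : forall w, 0 <= S w)
  (queue : MGinfty_input lambda S A V)
  (q_gt0 : 0 < q) (q_lt1 : q < 1) :
  0 < gamma_ q /\
  ((\int[lebesgue_measure]_(t in `[0%R, +oo[)
      (expR (- (gamma_ q * lambda * truncated_mean S t)))%:E < +oo)%E ->
   {ae P, forall w, \forall t \near +oo,
      ((q * lambda * truncated_mean S t)%:E <= in_service A V t w)%E}).
Proof.
have gamma0 := gamma_gt0 R q q_gt0 q_lt1; split=> // int_fin.
pose x n := q * lambda * truncated_mean S n.+1%:R.
pose B n := few_long_services P A V q n (x n).
have mB n : measurable (B n) by exact: measurable_few_long_services.
have sumB : (\sum_(n <oo) P (B n) < +oo)%E.
  pose g t := expR (- (gamma_ q * lambda * truncated_mean S t)).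
  apply: (@le_lt_trans _ _
      (\sum_(n <oo) (expR (2 * lambda * (1 - q)))%:E * (g n.+1%:R)%:E)%E).
    apply: lee_nneseries => // n _; exact: few_long_services_le.
  rewrite nneseriesZl; last by move=> n _; rewrite lee_fin expR_ge0.
  rewrite lte_mul_pinfty ?lee_fin ?expR_ge0//.
  apply: le_lt_trans (nneseries_le_integral R g _ _) int_fin => [t|s t s0 st].
    exact: expR_ge0.
  rewrite ler_expR lerN2 ler_wpM2l ?mulr_ge0 ?(ltW gamma0) ?(ltW lambda_gt0)//.
  exact: truncated_mean_homo.
exists (lim_sup_set B); split.
- by apply: bigcap_measurable => // n _; exact: bigcup_measurable.
- exact: lim_sup_set_cvg0.
(* By contraposition: if [w] avoids every [B n] with [n >= N], the bound holds for all [t > N],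
   since the integer part [n] of [t] is then at least [N]. *)
move=> w late N _; apply: contrapT => NB; apply: late.
exists N%:R; split=> // t Nt; have t0 : 0 <= t by rewrite (le_trans _ (ltW Nt)).
have /andP[nt tn] := truncn_itv t0; set n := Num.truncn t in nt tn.
have nB : ~ B n w.
  move=> Bn; apply: NB; exists n => //=.
  by rewrite -ltnS -(ltr_nat R) (lt_trans Nt tn).
apply: le_trans (in_service_ge _ _ _ _ _ q_gt0 q_lt1 _ _ _ nt (ltW tn) nB).
(* The threshold of [B n] uses the truncated mean at [n + 1], which dominates the one at [t]. *)
rewrite lee_fin ler_wpM2l ?mulr_ge0 ?(ltW q_gt0) ?(ltW lambda_gt0)//.
exact: truncated_mean_homo (ltW tn).
Qed.
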